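(* Let $G$ and $H$ be finitely generated free groups, with the rank of $H$ greater than $1$. Then the set $$S=\{(\phi,\psi,u,v)\mid \phi,\psi:G\to H \text{ homomorphisms},\ u,v\in H,\ [u]\neq[v]\}$$ is generic, where $[\cdot]$ denotes the doubly-twisted conjugacy class with respect to $\phi$ and $\psi$.
   Context: Doubly-twisted conjugacy: for homomorphisms $\phi,\psi:G\to H$ and $u,v\in H$, write $[u]=[v]$ if and only if there is some $g\in G$ with $u=\phi(g)\,v\,\psi(g)^{-1}$. Density and genericity: fix free generating sets of $G$ and $H$. For a natural number $p$, let $H_p$ be the set of elements of $H$ of (reduced) word length at most $p$. For a set $T\subset H^l$ of $l$-tuples, put $T_p=T\cap (H_p)^l$; the asymptotic density of $T$ is $D(T)=\lim_{p\to\infty}\frac{|T_p|}{|(H_p)^l|}$, and $T$ is generic if $D(T)=1$. With $G=\langle g_1,\dots,g_n\rangle$ of rank $n$, a homomorphism $\phi:G\to H$ is identified with the $n$-tuple $(\phi(g_1),\dots,\phi(g_n))\in H^n$. Accordingly a tuple $(\phi,\psi,u,v)$ is identified with an element of $H^{2n+2}$, and the density of $S$ is taken in $H^{2n+2}$. *)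

(* Defs.v *)
From HB Require Import structures.
From mathcomp Require Import all_boot all_order all_algebra finmap.
From mathcomp Require Import all_classical all_reals all_analysis.

Set Implicit Arguments.
Unset Strict Implicit.
Unset Printing Implicit Defensive.

Import numFieldNormedType.Exports.

Local Open Scope classical_set_scope.

(* The letter (i, false) stands for the i-th generator, (i, true) for its
   inverse. *)
Definition word (n : nat) := seq ('I_n * bool).

Definition reduced (n : nat) (w : word n) : bool :=
  sorted (fun a b => ~~ ((a.1 == b.1) && (a.2 != b.2))) w.

Definition word_eval (n : nat) (G : groupType) (g : n.-tuple G) (w : word n)
    : G :=
  (\prod_(a <- w) (if a.2 then (tnth g a.1)^-1 else tnth g a.1))%g.

(* G is free of rank n with ordered free generating set g. *)
Definition free_basis (n : nat) (G : groupType) (g : n.-tuple G) : Prop :=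
  forall x : G, exists! w : word n, reduced w /\ word_eval g w = x.

Definition ball_le (m : nat) (H : groupType) (h : m.-tuple H) (p : nat)
    : set H :=
  [set x | exists w : word m,
             [/\ reduced w, word_eval h w = x & (size w <= p)%N]].

Definition tuple_ball (m : nat) (H : groupType) (h : m.-tuple H) (l p : nat)
    : set (l.-tuple H) :=
  [set t | forall i : 'I_l, ball_le h p (tnth t i)].
Arguments tuple_ball {m H} h l p.

(* Only meaningful for finite A: fset_set sends infinite sets to fset0. *)
Definition set_card (T : choiceType) (A : set T) : nat := #|` fset_set A|%fset.

Definition has_density (R : realType) (m : nat) (H : groupType)
    (h : m.-tuple H) (l : nat) (T : set (l.-tuple H)) (d : R) : Prop :=
  ((set_card (T `&` tuple_ball h l p))%:R / (set_card (tuple_ball h l p))%:R : R)%R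
    @[p --> \oo] --> d.

Definition generic (R : realType) (m : nat) (H : groupType)
    (h : m.-tuple H) (l : nat) (T : set (l.-tuple H)) : Prop :=
  has_density h T (1%R : R).

Definition twisted_conj (G H : groupType) (phi psi : {multiplicative G -> H})
    (u v : H) : Prop :=
  exists g : G, u = (phi g * v * (psi g)^-1)%g.

Definition hom_quad (G H : groupType) : Type :=
  ({multiplicative G -> H} * {multiplicative G -> H} * H * H)%type.

(* The identification of (phi, psi, u, v) with a point of H^(2n+2). *)
Definition quad_tuple (n : nat) (G H : groupType) (g : n.-tuple G)
    (q : hom_quad G H) : (n + n + 2).-tuple H :=
  let: (phi, psi, u, v) := q in
  [tuple of ([tuple of map phi g] ++ [tuple of map psi g]) ++ [tuple u; v]].

Definition not_twisted_conj_set (G H : groupType) : set (hom_quad G H) :=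
  [set q | let: (phi, psi, u, v) := q in ~ twisted_conj phi psi u v].
Arguments not_twisted_conj_set G H : clear implicits.

(* Main.v *)
(* For L about p/3, all but a fraction O(2^-L) of the N-tuples of words of length
   at most p satisfy a small cancellation condition: every word has length at
   least 2L, and the 2N words and inverse words have distinct prefixes of length
   L.  Indeed each way of violating it lets one coordinate be recovered from the
   others and a word of length at most p - L, and there are 2^L times fewer of
   those.  A small cancellation tuple satisfies no nontrivial relation, whereas
   u = phi(x) v psi(x)^-1 is the nontrivial relation u^-1 phi(x) v psi(x)^-1 = 1
   among the entries of (phi, psi, u, v). *)
Require Import Defs.
From HB Require Import structures.
From mathcomp Require Import all_boot all_order all_algebra.
From mathcomp Require Import finmap zify.
From mathcomp Require Import all_classical all_reals all_analysis.

Set Implicit Arguments.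
Unset Strict Implicit.
Unset Printing Implicit Defensive.

Import Order.TTheory GRing.Theory Num.Theory.
Import numFieldNormedType.Exports.

(** * Reduced words: inverses and cancellation *)

Section Words.
Variable n : nat.
Implicit Types (a b : 'I_n * bool) (w x y z : word n).

Definition flip a := (a.1, ~~ a.2).

Definition winv w : word n := rev (map flip w).

Lemma flipK : involutive flip.
Proof. by case=> i b; rewrite /flip negbK. Qed.

Lemma flip_neq a : flip a != a.
Proof. by apply/eqP => /(congr1 snd) /=; case: a.2. Qed.

Lemma cancelE a b : (a.1 == b.1) && (a.2 != b.2) = (b == flip a).
Proof.
case: a b => [i s] [j t] /=; rewrite xpair_eqE eq_sym.
by case: s; case: t.
Qed.

Lemma reducedE w : reduced w = sorted (fun a b => b != flip a) w.
Proof. by rewrite /reduced; apply: eq_sorted => a b; rewrite cancelE. Qed.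

Lemma size_winv w : size (winv w) = size w.
Proof. by rewrite size_rev size_map. Qed.

Lemma winvK : involutive winv.
Proof. by move=> w; rewrite /winv map_rev revK mapK //; exact: flipK. Qed.

Lemma winv_cat x y : winv (x ++ y) = winv y ++ winv x.
Proof. by rewrite /winv map_cat rev_cat. Qed.

Lemma reduced_winv w : reduced (winv w) = reduced w.
Proof.
rewrite !reducedE /winv rev_sorted sorted_map; apply: eq_sorted => a b /=.
by rewrite flipK eq_sym.
Qed.

Lemma reduced_catl x y : reduced (x ++ y) -> reduced x.
Proof. by rewrite /reduced => /cat_sorted2[]. Qed.

Lemma reduced_catr x y : reduced (x ++ y) -> reduced y.
Proof. by rewrite /reduced => /cat_sorted2[]. Qed.

(** Words over disjoint sets of generators cannot cancel where they meet. The relation coming from a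
    twisted conjugacy is assembled from such blocks. *)
Lemma reduced_cat x y : reduced x -> reduced y ->
  {in x & y, forall a b, a.1 != b.1} -> reduced (x ++ y).
Proof.
case: y => [|b y] rx ry ne; first by rewrite cats0.
case: x rx ne => [|a x] //= rx ne; rewrite /reduced /= cat_path; apply/andP.
split=> //=; apply/andP; split=> //; rewrite negb_and ne //; first exact: mem_last.
by rewrite inE eqxx.
Qed.

Lemma reduced_rcons_cat x c z : reduced (rcons x c) -> reduced z ->
  (forall z', z <> flip c :: z') -> reduced (rcons x c ++ z).
Proof.
rewrite !reducedE; case: z => [|d z]; first by rewrite cats0.
move=> rx rz ne; have {}ne : d != flip c.
  by apply/eqP => dc; apply: (ne z); rewrite dc.
case: x rx => [|e x] /=; first by rewrite ne.
by rewrite cat_path last_rcons /= ne => ->.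
Qed.

(** Induction on [x] from its last letter, the one that meets [y]: either it cancels the head of [y]
    and goes into [p], or the concatenation is already reduced. *)
Lemma cancellation x y : reduced x -> reduced y -> exists p x' y',
  [/\ x = x' ++ winv p, y = p ++ y' & reduced (x' ++ y')].
Proof.
elim/last_ind: x y => [|x c IH] y rx ry.
  by exists [::], [::], y.
have rx' : reduced x by move: rx; rewrite -cats1 => /reduced_catl.
have [[z ez]|ne] := pselect (exists z, y = flip c :: z).
  have rz : reduced z by move: ry; rewrite ez -cat1s => /reduced_catr.
  have [p [x' [y' [ex ey r]]]] := IH _ rx' rz; rewrite ez ex ey.
  exists (flip c :: p), x', y'; split=> //.
  by rewrite /winv /= rev_cons flipK -!cats1 catA.
exists [::], (rcons x c), y; rewrite cats0; split=> //.
by apply: reduced_rcons_cat => // z ez; apply: ne; exists z.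
Qed.

(** If [p] had at least [L] letters, [winv x] and [y] would both start with its first [L]. So fewer
    than [L] letters of [x] cancel and more than [L] remain. *)
Lemma take_cancellation L x y w p x' y' :
  x = x' ++ winv p -> y = p ++ y' -> w = x' ++ y' ->
  (2 * L <= size x)%N -> take L (winv x) <> take L y -> take L w = take L x.
Proof.
move=> -> -> ->; rewrite size_cat size_winv => sz.
rewrite winv_cat winvK => ne.
have [lt|ge] := ltnP (size p) L; last by case: ne; rewrite !takel_cat.
by rewrite !takel_cat //; lia.
Qed.

End Words.

(** * Evaluation of words, and normal forms in a free group *)

Section Eval.
Variables (n : nat) (G : groupType) (g : n.-tuple G).
Implicit Types w : word n.
Local Open Scope group_scope.

Lemma word_eval_cat (x y : word n) : word_eval g (x ++ y) = word_eval g x * word_eval g y.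
Proof. by rewrite /word_eval big_cat. Qed.

Lemma word_eval_nil : word_eval g [::] = 1.
Proof. by rewrite /word_eval big_nil. Qed.

Lemma word_eval_cons a (x : word n) : word_eval g (a :: x) =
  (if a.2 then (tnth g a.1)^-1 else tnth g a.1) * word_eval g x.
Proof. by rewrite /word_eval big_cons. Qed.

Lemma word_eval_winv w : word_eval g (winv w) = (word_eval g w)^-1.
Proof.
elim: w => [|a w IH]; first by rewrite word_eval_nil invg1.
rewrite -cat1s winv_cat !word_eval_cat IH invgM; congr (_ * _).
rewrite /winv /= !word_eval_cons word_eval_nil !mulg1 /=.
by case: a.2 => //=; rewrite invgK.
Qed.

Lemma word_eval_cancel (x' p y' : word n) :
  word_eval g (x' ++ winv p) * word_eval g (p ++ y') = word_eval g (x' ++ y').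
Proof. by rewrite !word_eval_cat word_eval_winv mulgA mulgVK. Qed.

End Eval.

Section NormalForm.
Variables (n : nat) (G : groupType) (g : n.-tuple G).
Local Open Scope group_scope.

Hypothesis hg : free_basis g.

Definition nform (x : G) : word n := projT1 (cid (hg x)).

Lemma reduced_nform x : reduced (nform x).
Proof. by rewrite /nform; case: cid => w [[]]. Qed.

Lemma nformK : cancel nform (word_eval g).
Proof. by rewrite /nform => x; case: cid => w [[]]. Qed.

Lemma word_evalK w : reduced w -> nform (word_eval g w) = w.
Proof. by rewrite /nform => rw; case: cid => w' [_] /=; apply. Qed.

Lemma nform1 : nform 1 = [::].
Proof. by rewrite -(word_eval_nil g) word_evalK. Qed.

Lemma nformM (x y : G) : exists p x' y',
  [/\ nform x = x' ++ winv p, nform y = p ++ y' & nform (x * y) = x' ++ y'].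
Proof.
have [p [x' [y' [ex ey r]]]] := cancellation (reduced_nform x) (reduced_nform y).
exists p, x', y'; split=> //.
by rewrite -(nformK x) -(nformK y) ex ey word_eval_cancel word_evalK.
Qed.

Lemma nformV (x : G) : nform x^-1 = winv (nform x).
Proof.
by rewrite -{1}(nformK x) -word_eval_winv word_evalK // reduced_winv reduced_nform.
Qed.

Lemma nform_tnth i : nform (tnth g i) = [:: (i, false)].
Proof.
have -> : tnth g i = word_eval g [:: (i, false)].
  by rewrite word_eval_cons word_eval_nil mulg1.
exact: word_evalK.
Qed.

Section Lift.
Variables (H : groupType) (h : n.-tuple H).

Definition lift_hom (x : G) : H := word_eval h (nform x).

(** The part [p] that cancels between normal forms still cancels after evaluation at [h]; this gives
    the universal property of the free group. *)
Lemma lift_homM : {morph lift_hom : x y / x * y}.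
Proof.
move=> x y; rewrite /lift_hom; have [p [x' [y' [-> -> ->]]]] := nformM x y.
by rewrite word_eval_cancel.
Qed.

HB.instance Definition _ := isMultiplicative.Build G H lift_hom lift_homM.

Lemma lift_hom_gen i : lift_hom (tnth g i) = tnth h i.
Proof. by rewrite /lift_hom nform_tnth word_eval_cons word_eval_nil mulg1. Qed.

End Lift.

End NormalForm.

Lemma multiplicative1 (G H : groupType) (phi : {multiplicative G -> H}) :
  phi 1%g = 1%g.
Proof. by apply: (@mulgI _ (phi 1%g)); rewrite -gmulfM !mulg1. Qed.

Lemma multiplicativeV (G H : groupType) (phi : {multiplicative G -> H}) x :
  phi x^-1%g = (phi x)^-1%g.
Proof. by apply: (@mulIg _ (phi x)); rewrite -gmulfM !mulVg multiplicative1. Qed.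

Lemma multiplicative_word_eval n (G H : groupType) (g : n.-tuple G)
  (phi : {multiplicative G -> H}) w :
  phi (word_eval g w) = word_eval [tuple of map phi g] w.
Proof.
elim: w => [|a w IH]; first by rewrite !word_eval_nil multiplicative1.
rewrite !word_eval_cons gmulfM IH tnth_map.
by case: a.2; rewrite // multiplicativeV.
Qed.

(** * Small cancellation tuples satisfy no nontrivial relation *)

Section SmallCancellation.
Variables (m : nat) (H : groupType) (h : m.-tuple H) (hh : free_basis h).
Variables (N : nat) (t : N.-tuple H) (L : nat).

Definition sgn_word (b : bool) (w : word m) := if b then winv w else w.

(** The sign in ['I_N * bool] selects a word or its inverse, so each word is also compared with its
    own inverse. *)
Definition small_cancellation (f : 'I_N -> word m) :=
  [forall i, 2 * L <= size (f i)] &&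
  [forall a : 'I_N * bool, forall b : 'I_N * bool, (a != b) ==>
    (take L (sgn_word a.2 (f a.1)) != take L (sgn_word b.2 (f b.1)))].

Hypothesis sc : small_cancellation (fun i => nform hh (tnth t i)).

Let lets (a : 'I_N * bool) := sgn_word a.2 (nform hh (tnth t a.1)).

(* Multiplying by one more letter cancels fewer than L letters of its word, which
   has length at least 2L, so the first L letters survive. *)
Lemma take_nform_word_eval a (w : word N) : reduced (a :: w) ->
  take L (nform hh (word_eval t (a :: w))) = take L (lets a).
Proof.
have nlet b : lets b = nform hh (if b.2 then (tnth t b.1)^-1 else tnth t b.1)%g.
  by rewrite /lets /sgn_word; case: b.2; rewrite // nformV.
have letsV b : lets (flip b) = winv (lets b).
  by rewrite /lets /flip /sgn_word /=; case: b.2; rewrite //= winvK.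
case/andP: sc => /forallP sz /forallP dist.
have szl b : 2 * L <= size (lets b).
  by rewrite /lets /sgn_word; case: b.2; rewrite ?size_winv sz.
elim: w a => [|b w IH] a r.
  by rewrite word_eval_cons word_eval_nil mulg1 nlet.
rewrite word_eval_cons.
have [p [x' [y' [ex ey ->]]]] := nformM hh
  (if a.2 then (tnth t a.1)^-1 else tnth t a.1)%g (word_eval t (b :: w)).
rewrite -nlet in ex; apply: (take_cancellation ex ey) => //.
(* By induction the remaining product starts like [lets b], and [b != flip a] separates this prefix
   from that of the inverse of [lets a]. *)
move: r; rewrite reducedE /= => /andP[nab r]; rewrite IH ?reducedE // -letsV.
by move/forallP: (dist (flip a)) => /(_ b); rewrite eq_sym nab => /eqP.
Qed.

(** The value 1 has an empty normal form, which forces [L = 0]; but then the prefixes for [a] and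
    [flip a] are both empty, although they must differ. *)
Lemma small_cancellation_free a (w : word N) :
  reduced (a :: w) -> word_eval t (a :: w) <> 1%g.
Proof.
move=> /take_nform_word_eval + e; rewrite e nform1 /= => e0.
case/andP: (sc) => /forallP sz /forallP dist.
have L0 : L = 0.
  move/(congr1 size): e0; rewrite size_takel /lets /sgn_word //=.
  by case: a.2; rewrite ?size_winv; move: (sz a.1); lia.
move/forallP: (dist a) => /(_ (flip a)); rewrite eq_sym flip_neq /=.
by rewrite L0 !take0.
Qed.

End SmallCancellation.

Lemma small_cancellation_not_twisted n m (G H : groupType) (g : n.-tuple G)
    (h : m.-tuple H) (hg : free_basis g) (hh : free_basis h) L
    (phi psi : {multiplicative G -> H}) (u v : H) :
  small_cancellation L
    (fun i => nform hh (tnth (quad_tuple g (phi, psi, u, v)) i)) ->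
  ~ twisted_conj phi psi u v.
Proof.
move=> sc [x e].
(* [emb] renames generators: the normal form of [x] gets one copy in the letters of [phi] and one in
   those of [psi]. *)
pose emb k (f : 'I_n -> 'I_k) (w : word n) : word k :=
  map (fun a => (f a.1, a.2)) w.
pose fa i : 'I_(n + n + 2) := lshift 2 (lshift n i).
pose fb i : 'I_(n + n + 2) := lshift 2 (rshift n i).
pose iu : 'I_(n + n + 2) := rshift (n + n) ord0.
pose iv : 'I_(n + n + 2) := rshift (n + n) ord_max.
pose w := nform hg x.
pose t := quad_tuple g (phi, psi, u, v).
have rw : reduced w by exact: reduced_nform.
have remb k (f : 'I_n -> 'I_k) y : injective f -> reduced (emb k f y) = reduced y.
  move=> fi; rewrite !reducedE sorted_map; apply: eq_sorted => a b /=.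
  by rewrite /flip /= !xpair_eqE (inj_eq fi).
have evemb k (f : 'I_n -> 'I_k) (s : k.-tuple H) (chi : {multiplicative G -> H}) y :
    (forall i, tnth s (f i) = chi (tnth g i)) ->
    word_eval s (emb k f y) = chi (word_eval g y).
  move=> ef; rewrite multiplicative_word_eval /word_eval big_map.
  by apply: eq_bigr => a _ /=; rewrite ef tnth_map.
have fai : injective fa by move=> i j /lshift_inj/lshift_inj.
have fbi : injective fb by move=> i j /lshift_inj/rshift_inj.
(* u^-1 phi(x) v psi(x)^-1 is the value at t of a word that is already reduced. *)
have := @small_cancellation_free _ _ _ hh _ t L sc (iu, true)
  (emb _ fa w ++ (iv, false) :: winv (emb _ fb w)).
rewrite word_eval_cons word_eval_cat word_eval_cons word_eval_winv /=.
have tu : tnth t iu = u by rewrite /t /iu /quad_tuple tnth_rshift.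
have tv : tnth t iv = v by rewrite /t /iv /quad_tuple tnth_rshift.
rewrite (evemb _ _ _ phi); last first.
  by move=> i; rewrite /t /fa /quad_tuple !tnth_lshift tnth_map.
rewrite (evemb _ _ _ psi); last first.
  by move=> i; rewrite /t /fb /quad_tuple tnth_lshift tnth_rshift tnth_map.
rewrite tu tv nformK; apply; last by rewrite (mulgA (phi x)) -e mulVg.
have memb k (f : 'I_n -> 'I_k) y a : a \in emb k f y -> exists i, a.1 = f i.
  by case/mapP => c _ ->; exists c.1.
have memV k (f : 'I_n -> 'I_k) y a :
    a \in winv (emb k f y) -> exists i, a.1 = f i.
  by rewrite mem_rev => /mapP[c /memb[i ei] ->]; exists i.
apply: (@reduced_cat _ [:: (iu, true)]) => //.
  apply: reduced_cat; first by rewrite remb.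
    rewrite -cat1s; apply: reduced_cat => //; first by rewrite reduced_winv remb.
    move=> a b; rewrite inE => /eqP-> /memV[i ->].
    by apply/eqP => /(congr1 val) /=; have := ltn_ord i; lia.
  move=> a b /memb[i ->]; rewrite inE => /orP[/eqP->|/memV[j ->]];
    by apply/eqP => /(congr1 val) /=; have := ltn_ord i; lia.
move=> a b; rewrite inE => /eqP->; rewrite mem_cat inE.
by case/or3P => [/memb[j ->]|/eqP->|/memV[j ->]];
  apply/eqP => /(congr1 val) /=; try (have := ltn_ord j); lia.
Qed.

(** * Counting reduced words of bounded length *)

Section Extend.
Variables (m : nat) (i0 i1 : 'I_m).
Implicit Types (w : word m) (s : seq bool).

(** A generator other than that of the first letter when [i0 != i1], so that a letter of either sign
    can be prepended without cancellation. *)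
Definition fresh w := if w is a :: _ then if a.1 == i0 then i1 else i0 else i0.

(* The fresh letters leave their sign free, so extend s embeds 2^|s| copies of the
   reduced words of length at most k into those of length at most k + |s|. *)
Definition extend s w : word m := foldr (fun b v => (fresh v, b) :: v) w s.

Lemma size_extend s w : size (extend s w) = (size s + size w)%N.
Proof. by elim: s => //= b s ->. Qed.

Lemma extend_inj s s' w w' : size s = size s' ->
  extend s w = extend s' w' -> s = s' /\ w = w'.
Proof.
elim: s s' => [|b s IH] [|b' s'] //= [/IH{}IH] [_ -> /IH[-> ->]].
by [].
Qed.

Hypothesis i01 : i0 != i1.

Lemma reduced_extend s w : reduced w -> reduced (extend s w).
Proof.
move=> rw; elim: s => //= b s; rewrite /reduced.
case: (extend s w) => //= a v ->; rewrite andbT negb_and.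
case: (eqVneq a.1 i0) => [->|ne]; first by rewrite eq_sym i01.
by rewrite eq_sym ne.
Qed.

End Extend.

Section Ball.
Variables (m p : nat).

Definition ball_word : finType := {w : p.-bseq ('I_m * bool) | reduced w}.

Definition word_of (t : ball_word) : word m := val t.

Lemma word_of_inj : injective word_of.
Proof. by move=> s t /val_inj/val_inj. Qed.

Lemma reduced_word_of t : reduced (word_of t).
Proof. exact: valP t. Qed.

Lemma size_word_of t : (size (word_of t) <= p)%N.
Proof. exact: size_bseq. Qed.

Lemma word_of_surj w :
  reduced w -> (size w <= p)%N -> exists t : ball_word, word_of t = w.
Proof.
move=> rw sw; pose b : p.-bseq ('I_m * bool) := Bseq sw.
have rb : reduced b by [].
by exists (exist _ b rb).
Qed.

Lemma ball_word_gt0 : (0 < #|ball_word|)%N.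
Proof. by have [t _] := @word_of_surj [::] isT isT; apply/card_gt0P; exists t. Qed.

Hypothesis hm : (1 < m)%N.
Variables (L : nat) (hL : (L <= p)%N).

(** Extending the code [k t] by [L] free signs embeds [S] times the sign sequences of length [L]
    into the ball. *)
Lemma card_compressible (S : pred ball_word) (k : ball_word -> word m) :
  (forall t, S t -> reduced (k t) /\ (size (k t) <= p - L)%N) ->
  {in S &, injective k} -> (#|S| * 2 ^ L <= #|ball_word|)%N.
Proof.
move=> hk injk; pose i0 : 'I_m := Ordinal (ltnW hm); pose i1 : 'I_m := Ordinal hm.
have i01 : i0 != i1 by [].
pose F (q : ball_word * L.-tuple bool) :=
  odflt q.1 [pick t | word_of t == extend i0 i1 q.2 (k q.1)].
have FE q : S q.1 -> word_of (F q) = extend i0 i1 q.2 (k q.1).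
  move=> /hk[rk sk]; rewrite /F; case: pickP => [t /eqP //|no].
  have [||t et] := @word_of_surj (extend i0 i1 q.2 (k q.1)).
  - exact: reduced_extend.
  - by rewrite size_extend size_tuple; lia.
  - by have := no t; rewrite et eqxx.
have -> : (2 ^ L = #|{: L.-tuple bool}|)%N by rewrite card_tuple card_bool.
rewrite -cardX -(@card_in_image _ _ F) ?max_card //.
move=> [t s] [t' s']; rewrite !inE !andbT /= => St St' /(congr1 word_of).
rewrite !FE //= => /extend_inj[|es /injk ->] //; first by rewrite !size_tuple.
by rewrite (val_inj es).
Qed.

(** A short word is its own code: [3 * L <= p] puts lengths below [2 * L] within [p - L]. *)
Lemma card_short : (3 * L <= p)%N ->
  (#|[pred t : ball_word | size (word_of t) < 2 * L]| * 2 ^ L <= #|ball_word|)%N.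
Proof.
move=> h3; apply: (@card_compressible _ word_of); last by move=> ? ? _ _ /word_of_inj.
by move=> t /= st; split; [exact: reduced_word_of | lia].
Qed.

Lemma sgn_word_inj b : injective (@sgn_word m b).
Proof. by case: b => //; exact: can_inj (@winvK m). Qed.

Lemma size_sgn_word b w : size (@sgn_word m b w) = size w.
Proof. by case: b; rewrite //= size_winv. Qed.

Lemma reduced_sgn_word b w : reduced (@sgn_word m b w) = reduced w.
Proof. by case: b; rewrite //= reduced_winv. Qed.

(** The code is the word without its first [L] letters, which [r] restores. *)
Lemma card_determined_prefix b (r : word m -> word m) :
  (#|[pred t : ball_word | take L (sgn_word b (word_of t)) ==
                           r (drop L (sgn_word b (word_of t)))]| * 2 ^ L
   <= #|ball_word|)%N.
Proof.
apply: (@card_compressible _ (fun t => drop L (sgn_word b (word_of t)))).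
  move=> t _; split; last first.
    by rewrite size_drop size_sgn_word leq_sub2r // size_word_of.
  apply: (@reduced_catr _ (take L (sgn_word b (word_of t)))).
  by rewrite cat_take_drop reduced_sgn_word reduced_word_of.
move=> t t'; rewrite !inE => /eqP et /eqP et' ed.
apply/word_of_inj/(@sgn_word_inj b).
by rewrite -(cat_take_drop L (sgn_word b _)) et ed -et' cat_take_drop.
Qed.

End Ball.

Lemma sum_pred (T : finType) (P : pred T) : (\sum_t P t = #|P|)%N.
Proof.
rewrite -sum1_card [RHS]big_mkcond; apply: eq_bigr => t _.
by rewrite unfold_in; case: (P t).
Qed.

(** * Counting tuples of reduced words *)

Section Fibers.
Variables (I T : finType) (i : I).

Definition upd (f : {ffun I -> T}) t : {ffun I -> T} :=
  [ffun j => if j == i then t else f j].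

(** Carries a bound for one varying word, the others being fixed, over to tuples. *)
Lemma card_fibers (E : pred {ffun I -> T}) K : (0 < #|T|)%N ->
  (forall f, #|[pred t | E (upd f t)]| * K <= #|T|)%N ->
  (#|E| * K <= #|{ffun I -> T}|)%N.
Proof.
move=> T0 hE; rewrite -(leq_pmul2r T0).
(* Double counting through the involution swapping the i-th value with the spare
   one. *)
pose s (q : {ffun I -> T} * T) := (upd q.1 q.2, q.1 i).
have sK : involutive s.
  case=> f t; rewrite /s /=; congr (_, _); last by rewrite ffunE eqxx.
  by apply/ffunP => j; rewrite !ffunE; case: eqP => // ->.
have -> : (#|E| * K * #|T| = \sum_f #|[pred t | E (upd f t)]| * K)%N.
  rewrite -big_distrl /= mulnAC; congr (_ * _)%N.
  under eq_bigr do rewrite -sum_pred.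
  rewrite pair_bigA /= [RHS](reindex_inj (inv_inj sK)) /=.
  have sK1 q : upd (s q).1 (s q).2 = q.1 by exact: (congr1 fst (sK q)).
  under [RHS]eq_bigr => q _ do rewrite sK1.
  rewrite -(pair_bigA _ (fun f t => nat_of_bool (E f))) /= -(sum_pred E) big_distrl /=.
  by apply: eq_bigr => f _; rewrite sum_nat_const mulnC.
by rewrite (leq_trans (@leq_sum _ _ xpredT _ _ (fun f _ => hE f))) ?sum_nat_const.
Qed.

End Fibers.

(** Union bound over [N] events [A i] and [(2 * N) ^ 2] events [B a b], each of proportion at most
    [2 ^ -L]. *)
Lemma card_not_small_cancellation m N p L : (1 < m)%N -> (3 * L <= p)%N ->
  (#|[pred f : {ffun 'I_N -> ball_word m p} |
      ~~ small_cancellation L (fun i => word_of (f i))]| * 2 ^ L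
   <= (N + (2 * N) ^ 2) * #|{ffun 'I_N -> ball_word m p}|)%N.
Proof.
move=> hm h3; have hL : (L <= p)%N by lia.
pose X := {ffun 'I_N -> ball_word m p}.
pose A (i : 'I_N) := [pred f : X | size (word_of (f i)) < 2 * L].
(* Short words are left to [A]; the length condition serves the comparison of a word with its
   inverse. *)
pose B (a b : 'I_N * bool) := [pred f : X |
  [&& a != b, 2 * L <= size (word_of (f a.1)) &
      take L (sgn_word a.2 (word_of (f a.1))) ==
      take L (sgn_word b.2 (word_of (f b.1)))]].
have hA i : (#|A i| * 2 ^ L <= #|{: X}|)%N.
  apply: (@card_fibers _ _ i); first exact: ball_word_gt0.
  move=> f; apply: leq_trans (card_short hm hL h3); rewrite leq_mul2r.
  by apply/orP; right; apply/eq_leq/eq_card => t; rewrite !inE ffunE eqxx.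
have hB a b : (#|B a b| * 2 ^ L <= #|{: X}|)%N.
  have [->|nab] := eqVneq a b.
    by rewrite (_ : #|_| = 0%N) //; apply: eq_card0 => f; rewrite !inE eqxx.
  apply: (@card_fibers _ _ a.1); first exact: ball_word_gt0.
  move=> f; have [eab|neab] := eqVneq b.1 a.1.
    apply: leq_trans (card_determined_prefix hm hL a.2 (fun d => take L (winv d))).
    rewrite leq_mul2r; apply/orP; right; apply: subset_leq_card.
    apply/fintype.subsetP => t.
    rewrite !inE !ffunE eab eqxx => /and3P[_ sz /eqP->].
    have -> : sgn_word b.2 (word_of t) = winv (sgn_word a.2 (word_of t)).
      case: a b eab nab {sz} => [i s] [j s'] /= ->; rewrite xpair_eqE eqxx /=.
      by case: s; case: s' => //=; rewrite winvK.
    (* If w and its inverse share their first L letters, these are also the first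
       L letters of the inverse of the rest of w. *)
    rewrite -{1}(cat_take_drop L (sgn_word a.2 _)) winv_cat takel_cat //.
    by rewrite size_winv size_drop size_sgn_word; lia.
  (* The word at [b.1] stays fixed while that at [a.1] varies, so the prescribed prefix is
     constant. *)
  apply: leq_trans (card_determined_prefix hm hL a.2
    (fun=> take L (sgn_word b.2 (word_of (f b.1))))).
  rewrite leq_mul2r; apply/orP; right; apply: subset_leq_card.
  apply/fintype.subsetP => t.
  by rewrite !inE !ffunE eqxx (negbTE neab) => /and3P[].
apply: (@leq_trans ((\sum_i #|A i| + \sum_a \sum_b #|B a b|) * 2 ^ L)%N).
  rewrite leq_mul2r; apply/orP; right.
  (* With the sum over [f] outermost, it remains that each failing [f] lies in some [A i] or
     [B a b]. *)
  rewrite -sum_pred; under [X in (X + _)%N]eq_bigr do rewrite -sum_pred.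
  under [X in (_ + X)%N]eq_bigr do under eq_bigr do rewrite -sum_pred.
  under [X in (_ + X)%N]eq_bigr do rewrite exchange_big /=.
  rewrite exchange_big /= [X in (_ + X)%N]exchange_big /= -big_split /=.
  apply: leq_sum => f _; case: (boolP (small_cancellation _ _)) => //=.
  rewrite negb_and !negb_forall => /orP[/existsP[i]|].
    by rewrite -ltnNge => si; rewrite (bigD1 i) //= si.
  move=> /existsP[a]; rewrite negb_forall => /existsP[b].
  rewrite negb_imply negbK => /andP[nab eab].
  have [si|si] := ltnP (size (word_of (f a.1))) (2 * L).
    by rewrite (bigD1 a.1) //= si.
  by rewrite addnC (bigD1 a) //= (bigD1 b) //= nab eab si.
rewrite mulnDl mulnDl leq_add //.
  rewrite big_distrl /= (leq_trans (@leq_sum _ _ xpredT _ _ (fun i _ => hA i))) //.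
  by rewrite sum_nat_const card_ord.
rewrite big_distrl /=; under eq_bigr do rewrite big_distrl /=.
rewrite (leq_trans (@leq_sum _ _ xpredT _ _ (fun a _ =>
  @leq_sum _ _ xpredT _ _ (fun b _ => hB a b)))) //.
by rewrite !sum_nat_const card_prod card_ord card_bool mulnA mulnn (mulnC N).
Qed.

(** * From finite counts to asymptotic density *)

Local Open Scope classical_set_scope.

(** Freeness of [G] extends arbitrary values on [g] to homomorphisms. *)
Lemma quad_tuple_surj n (G H : groupType) (g : n.-tuple G) (hg : free_basis g)
  (t : (n + n + 2).-tuple H) : exists q : hom_quad G H, quad_tuple g q = t.
Proof.
pose a := [tuple tnth t (lshift 2 (lshift n i)) | i < n].
pose b := [tuple tnth t (lshift 2 (rshift n i)) | i < n].
pose u := tnth t (rshift (n + n) ord0).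
pose v := tnth t (rshift (n + n) ord_max).
exists (lift_hom hg a : {multiplicative G -> H},
        lift_hom hg b : {multiplicative G -> H}, u, v).
apply/eq_from_tnth => i; rewrite /quad_tuple -(fintype.splitK i).
case: (fintype.split i) => /= j; rewrite ?tnth_lshift ?tnth_rshift.
  rewrite -(fintype.splitK j); case: (fintype.split j) => k /=;
  rewrite ?tnth_lshift ?tnth_rshift;
  by rewrite tnth_map lift_hom_gen tnth_mktuple.
case: j => [[|[|//]] hj]; rewrite (tnth_nth u) /=; congr tnth; exact: val_inj.
Qed.

(** Writing the image as a finite set keeps [set_card] away from its default value on infinite
    sets. *)
Lemma set_card_image (F : finType) (T : choiceType) (f : F -> T) (P : pred F) :
  injective f -> set_card (f @` [set x | P x]) = #|P|.
Proof.
move=> fi; pose A := [fset f x | x in P]%fset.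
have -> : f @` [set x | P x] = [set` A].
  apply/seteqP; split=> [_ [x Px <-]|y] /=.
    by apply/imfsetP; exists x.
  by case/imfsetP => x /= Px ->; exists x.
by rewrite /set_card set_fsetK card_imfset //= cardE.
Qed.

Section EvalBall.
Variables (m : nat) (H : groupType) (h : m.-tuple H) (hh : free_basis h).
Variables (N p : nat).

Definition eval_tuple (f : {ffun 'I_N -> ball_word m p}) : N.-tuple H :=
  [tuple word_eval h (word_of (f i)) | i < N].

Lemma nform_eval_tuple f i : nform hh (tnth (eval_tuple f) i) = word_of (f i).
Proof. by rewrite tnth_mktuple word_evalK // reduced_word_of. Qed.

Lemma eval_tuple_inj : injective eval_tuple.
Proof.
move=> f f' e; apply/ffunP => i; apply: word_of_inj.
by rewrite -!nform_eval_tuple e.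
Qed.

Lemma range_eval_tuple : range eval_tuple = tuple_ball h N p.
Proof.
apply/seteqP; split=> [_ [f _ <-] i|t ht] /=.
  rewrite tnth_mktuple; exists (word_of (f i)).
  by split=> //; [exact: reduced_word_of | exact: size_word_of].
have ex i : exists s : ball_word m p, word_eval h (word_of s) = tnth t i.
  by have [w [rw <- /(word_of_surj rw)[s <-]]] := ht i; exists s.
have [f hf] := choice ex.
exists [ffun i => f i] => //; apply: eq_from_tnth => i.
by rewrite tnth_mktuple ffunE hf.
Qed.

Lemma set_card_tuple_ball :
  set_card (tuple_ball h N p) = #|{ffun 'I_N -> ball_word m p}|.
Proof.
rewrite -range_eval_tuple -(set_card_image _ eval_tuple_inj).
by congr (set_card (_ @` _)); apply/seteqP; split.
Qed.

Lemma set_card_setI_tuple_ball (T : set (N.-tuple H)) :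
  set_card (T `&` tuple_ball h N p) = #|[pred f | `[< T (eval_tuple f) >]]|.
Proof.
rewrite -range_eval_tuple -(set_card_image _ eval_tuple_inj); congr set_card.
apply/seteqP; split=> [t [Tt [f _ e]]|_ [f /= /asboolP Tf <-]].
  by exists f => //=; apply/asboolP; rewrite e.
by split=> //; exists f.
Qed.

End EvalBall.

(** With [L = p %/ 3] the exceptional proportion is at most [C / (p + 1)], and squeezing applies. *)
Lemma generic_small_cancellation (R : realType) m (H : groupType)
    (h : m.-tuple H) (hh : free_basis h) N (T : set (N.-tuple H)) :
  (1 < m)%N ->
  (forall t L, small_cancellation L (fun i => nform hh (tnth t i)) -> T t) ->
  generic R h T.
Proof.
move=> hm hT; rewrite /generic /has_density.
pose C : R := ((N + (2 * N) ^ 2)%:R * 3)%R.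
apply: (@squeeze_cvgr _ _ _ R (fun p => 1 - C * harmonic p)%R (cst 1%R));
  last exact: cvg_cst.
- near=> p.
  rewrite set_card_tuple_ball // set_card_setI_tuple_ball //.
  pose X := {ffun 'I_N -> ball_word m p}.
  set P := [pred f : X | _].
  have X0 : (0 < #|{: X}|%:R :> R)%R.
    rewrite ltr0n card_ffun expn_gt0 /ball_word ball_word_gt0 //.
  have PC : (#|P| + #|predC P| = #|{: X}|)%N by rewrite cardC.
  have bad : (#|predC P| * 2 ^ (p %/ 3) <= (N + (2 * N) ^ 2) * #|{: X}|)%N.
    have h3 : (3 * (p %/ 3) <= p)%N by rewrite mulnC leq_divM.
    apply: leq_trans (card_not_small_cancellation N hm h3).
    rewrite leq_mul2r; apply/orP; right.
    apply: subset_leq_card; apply/fintype.subsetP => f; rewrite !inE.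
    apply: contra => sc; apply/asboolP/(hT _ (p %/ 3)).
    by rewrite (_ : (fun i => _) = (fun i => word_of (f i))) //;
      apply/funext => i; rewrite nform_eval_tuple.
  (* Writing [p = 3 * q + r] with [r <= 2] gives [p + 1 <= 3 * (q + 1) <= 3 * 2 ^ q], the source of
     the factor 3 in [C]. *)
  have pow : (p.+1 <= 3 * 2 ^ (p %/ 3))%N.
    have := ltn_expl (p %/ 3) (isT : 1 < 2)%N; have := ltn_pmod p (isT : 0 < 3)%N.
    by have := divn_eq p 3; lia.
  have bad' : (#|predC P| * p.+1 <= (N + (2 * N) ^ 2) * 3 * #|{: X}|)%N.
    apply: (@leq_trans (#|predC P| * (3 * 2 ^ (p %/ 3)))%N).
      by rewrite leq_mul2l pow orbT.
    by rewrite mulnCA mulnAC [X in (_ <= X)%N]mulnC leq_mul2l bad.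
  rewrite ler_pdivlMr // ler_pdivrMr // mul1r ler_nat -PC leq_addr andbT.
  rewrite mulrBl mul1r lerBlDr natrD lerD2l -natrD PC /harmonic /= -mulrA mulrCA.
  rewrite mulrC -ler_pdivrMr ?invrK ?invr_gt0 ?ltr0n //.
  by rewrite /C -!natrM ler_nat.
- rewrite -[X in _ --> X]subr0 -[X in (_ - X)%R](mulr0 C).
  apply: cvgB; first exact: cvg_cst.
  by apply: cvgM; [exact: cvg_cst | exact: cvg_harmonic].

Unshelve. all: by end_near.
Qed.

Theorem theorem10 (R : realType) (G H : groupType) (n m : nat)
    (g : n.-tuple G) (h : m.-tuple H)
    (hG : free_basis g) (hH : free_basis h) (hm : (1 < m)%N) :
  generic R h (quad_tuple g @` not_twisted_conj_set G H).
Proof.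
apply: (@generic_small_cancellation R m H h hH (n + n + 2) _ hm) => t L.
have [[[[phi psi] u] v] <-] := quad_tuple_surj hG t.
move=> /(small_cancellation_not_twisted hG) ntc.
by exists (phi, psi, u, v).
Qed.
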